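(* Let $\pi:A\to B$ be a surjective map between nonempty countable sets. Let $p\in [0,1]$. For every $b\in B$, let $X_b$ and $X^\dagger_b$ be Bernoulli random variables of parameter $p$, such that the collection formed by all the $X_b$'s and all the $X^\dagger_b$'s is independent. Let $S$ and $S^\dagger$ be random sections of $\pi$ (defined on the same probability space) such that, for every $b\in B$, almost surely $S(b)\neq S^\dagger(b)$. Then, after possibly extending the probability space, there exist $\{0,1\}$-valued random variables $(Y_a)_{a\in A}$ and $(Z_a)_{a\in A}$ such that, almost surely: (1)(a) for every $a\in A$, if $a\notin \{S(\pi(a)),S^\dagger(\pi(a))\}$ then $Y_a=0$; (b) for every $b$ with $X_b=0$ and $X^\dagger_b=0$, we have $Y_{S(b)}=0$ and $Y_{S^\dagger(b)}=0$; (c) for every $b$ with $X_b=1$ and $X^\dagger_b=0$, we have $Y_{S(b)}=1$ and $Y_{S^\dagger(b)}=0$; (d) for every $b$ with $X_b=1$ and $X^\dagger_b=1$, we have $Y_{S(b)}=1$ and $Y_{S^\dagger(b)}=1$; (e) for every $b$ with $X_b=0$ and $X^\dagger_b=1$, exactly one $a\in\{S(b),S^\dagger(b)\}$ satisfies $Y_a=1$; (2) the distribution of $(Z_a)_{a\in A}$ is $\mathrm{Bernoulli}(p)^{\otimes A}$; (3) for every $a\in A$, $Y_a\le Z_a$.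
   Context: A (random) section of $\pi$ is a (random) map $s:B\to A$ with $\pi\circ s=\mathrm{id}_B$. An extension of a probability space $(\Omega,\mathscr F,\mathbb P)$ is a probability space $(\Omega^\star,\mathscr F^\star,\mathbb P^\star)$ with a measurable map $\varphi:\Omega^\star\to\Omega$ whose pushforward of $\mathbb P^\star$ is $\mathbb P$; random variables $X$ on $\Omega$ are regarded on $\Omega^\star$ as $X\circ\varphi$. ''Countable'' means finite or countably infinite. *)

(* Defs.v *)
From HB Require Import structures.
From mathcomp Require Import all_boot all_order all_algebra.
From mathcomp Require Import all_classical all_reals all_analysis.
From mathcomp Require Import finmap.
Set Implicit Arguments. Unset Strict Implicit. Unset Printing Implicit Defensive.
Import Order.TTheory GRing.Theory Num.Theory.
Local Open Scope classical_set_scope.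
Local Open Scope ereal_scope.

(* A {0,1}-valued random variable is represented as a map T -> bool
   (true = 1, false = 0); it is a random variable iff [set w | X w] is
   measurable. *)
Definition bool_rv d (T : measurableType d) (X : T -> bool) :=
  measurable [set w | X w].

Definition indep_bool_family d (T : measurableType d) (R : realType)
    (P : probability T R) (I : choiceType) (X : I -> T -> bool) :=
  forall (F : {fset I}) (v : I -> bool),
    P (\bigcap_(i in [set` F]) [set w | X i w = v i])
    = \big[*%E/1%E]_(i <- F) P [set w | X i w = v i].

Definition bernoulli_rv d (T : measurableType d) (R : realType)
    (P : probability T R) (p : R) (X : T -> bool) :=
  bool_rv X /\ P [set w | X w] = p%:E.

(* The law of (Z_a)_{a in A} is Bernoulli(p)^{(x) A}: the Z_a are independent
   and each is Bernoulli(p) (this prescribes all finite-dimensional marginals,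
   which determine the law on the product sigma-algebra of {0,1}^A). *)
Definition iid_bernoulli_family d (T : measurableType d) (R : realType)
    (P : probability T R) (p : R) (I : choiceType) (Z : I -> T -> bool) :=
  (forall i, bernoulli_rv P p (Z i)) /\ indep_bool_family P Z.

(* A random section of pi : A -> B: a map S : T -> (B -> A) such that each
   S(b) is an A-valued random variable (A countable, discrete sigma-algebra)
   and pi (S w b) = b for all w, b. *)
Definition random_section d (T : measurableType d) (A B : countType)
    (pi : A -> B) (S : T -> B -> A) :=
  (forall b a, measurable [set w | S w b = a]) /\
  (forall w b, pi (S w b) = b).

Definition extension d (T : measurableType d) (R : realType)
    (P : probability T R) d' (T' : measurableType d') (P' : probability T' R)
    (phi : T' -> T) :=
  measurable_fun setT phi /\
  (forall E, measurable E -> P' (phi @^-1` E) = P E).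

Definition join_family (B : Type) (T : Type) (X Xd : B -> T -> bool)
  (i : B + B) : T -> bool :=
  match i with inl b => X b | inr b => Xd b end.

(* Main.v *)
(* The sections may depend on all the bits, so no naive sampling works; the
   coupling comes from Hall's theorem. After replacing A by B x A, the Z-bits
   split into independent fibres. For one fibre and any event U on its Z-bits,
   the probability that an adversary seeing (X_b, X'_b) can choose S(b) <> S'(b)
   such that every configuration compatible with (1) lies in U is at most P(U).
   This inequality tensorizes over fibres, even against an adversary who sees
   everything, and is exactly the condition of the weighted Hall theorem for
   coupling the law of (X, X', S, S') with Bernoulli(p) bits, as long as
   finitely many points are considered.
   Along an ultrafilter the finite couplings converge to a finitely additive
   joint law on (Omega, bits). Its Omega-sections are dominated by P, hence
   countably additive, so they have densities; these are the lengths of nested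
   random intervals of [0, 1[, and one uniform variable independent of Omega
   then samples the bits. *)

Require Import Defs.
From HB Require Import structures.
From mathcomp Require Import all_boot all_order all_algebra.
From mathcomp Require Import all_classical all_reals all_analysis.
From mathcomp Require Import finmap.
From mathcomp Require Import measurable_realfun lra.
Import Order.TTheory GRing.Theory Num.Theory.
Import numFieldNormedType.Exports.
Local Open Scope classical_set_scope.
Local Open Scope ring_scope.
Set Implicit Arguments.
Unset Strict Implicit.
Unset Printing Implicit Defensive.

(** * Weighted Hall theorem *)

Section WeightedHall.
Context {R : realFieldType} {I J : finType} (r : I -> J -> bool).

Definition neighbours (C : {set I}) : {set J} :=
  [set j | [exists i in C, r i j]]%SET.

Definition hall_condition (f : I -> R) (g : J -> R) :=
  forall C : {set I}, \sum_(i in C) f i <= \sum_(j in neighbours C) g j.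

(** The second marginal is only bounded by [g], so that partial flows can be added; equality is
    recovered in [coupling_marginal] when the total masses agree. *)
Definition coupling (f : I -> R) (g : J -> R) (K : I -> J -> R) :=
  [/\ forall i j, 0 <= K i j, forall i j, ~~ r i j -> K i j = 0,
      forall i, \sum_j K i j = f i & forall j, \sum_i K i j <= g j].

Lemma neighboursU (C D : {set I}) :
  neighbours (C :|: D) = neighbours C :|: neighbours D.
Proof.
apply/finset.setP => j; rewrite !inE; apply/existsP/orP.
  move=> [i /andP[]]; rewrite inE => /orP[iC|iD] rij; [left|right];
  by apply/existsP; exists i; rewrite ?iC ?iD.
by move=> [] /existsP[i /andP[iC rij]]; exists i; rewrite inE iC ?orbT.
Qed.

Let supp (T : finType) (f : T -> R) := #|[set i | f i != 0]%SET|.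

Let supp_lt (T : finType) (f f' : T -> R) i :
  (forall j, f j = 0 -> f' j = 0) -> f i != 0 -> f' i = 0 ->
  (supp f' < supp f)%N.
Proof.
move=> ff' fi f'i; apply: proper_card; apply/properP; split.
  by apply/fintype.subsetP => j; rewrite !inE; apply: contraNneq => /ff' ->.
by exists i; rewrite inE ?fi// f'i eqxx.
Qed.

Let supp_le (T : finType) (f f' : T -> R) :
  (forall j, f j = 0 -> f' j = 0) -> (supp f' <= supp f)%N.
Proof.
move=> ff'; apply: subset_leq_card; apply/fintype.subsetP => j.
by rewrite !inE; apply: contraNneq => /ff' ->.
Qed.

Lemma sum_restrict (T : finType) (f : T -> R) (A B : {set T}) :
  \sum_(i in A) (if i \in B then f i else 0) = \sum_(i in A :&: B) f i.
Proof. by rewrite -big_mkcondr; apply: eq_bigl => i; rewrite inE. Qed.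

Lemma coupling_sum (f1 f2 f : I -> R) (g1 g2 g : J -> R) K1 K2 :
  coupling f1 g1 K1 -> coupling f2 g2 K2 ->
  (forall i, f i = f1 i + f2 i) -> (forall j, g j = g1 j + g2 j) ->
  coupling f g (fun i j => K1 i j + K2 i j).
Proof.
move=> [p1 z1 s1 t1] [p2 z2 s2 t2] ff gg; split=> [i j|i j rij|i|j].
- exact: addr_ge0.
- by rewrite z1// z2// addr0.
- by rewrite big_split/= s1 s2 ff.
- by rewrite big_split/= gg lerD.
Qed.

(* Halmos-Vaughan: push flow through one edge until a weight vanishes or some
   set becomes tight, in which case the problem splits. *)
Lemma weighted_hall (f : I -> R) (g : J -> R) :
  (forall i, 0 <= f i) -> (forall j, 0 <= g j) -> hall_condition f g ->
  exists K, coupling f g K.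
Proof.
(* Induction on the number of nonzero weights on both sides. *)
have [n] := ubnP (supp f + supp g); elim: n f g => // n IH f g.
rewrite ltnS => le_n f0 g0 H.
have [/forallP fz|] := boolP [forall i, f i == 0].
  exists (fun _ _ => 0); split => // [i|j]; rewrite big1//.
  by rewrite (eqP (fz i)).
rewrite negb_forall => /existsP[i fi].
have fi0 : 0 < f i by rewrite lt_neqAle eq_sym fi f0.
have [j rij gj] : exists2 j, r i j & g j != 0.
  apply/exists_inP/negbNE; rewrite negb_exists_in; apply/negP => /forallP gz.
  have := H [set i]%SET; rewrite big_set1 big1 ?leNgt ?fi0// => j.
  rewrite inE => /existsP[i' /andP[/finset.set1P -> rij]].
  by have := gz j; rewrite rij negbK => /eqP.
have gj0 : 0 < g j by rewrite lt_neqAle eq_sym gj g0.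
pose slack (C : {set I}) := \sum_(k in neighbours C) g k - \sum_(k in C) f k.
have slack0 C : 0 <= slack C by rewrite subr_ge0.
(* Pushing [t] along the edge [(i, j)] costs slack only for these sets: if [i] is in [C], then [j]
   is a neighbour and both sides lose [t]. *)
pose crit (C : {set I}) := (i \notin C) && (j \in neighbours C).
pose t := \big[Order.min/Order.min (f i) (g j)]_(C : {set I} | crit C) slack C.
have t_le : t <= Order.min (f i) (g j) by exact: bigmin_le_id.
have t_f : t <= f i by apply: le_trans t_le _; rewrite ge_min lexx.
have t_g : t <= g j by apply: le_trans t_le _; rewrite ge_min lexx orbT.
have t_slack C : crit C -> t <= slack C by move=> cC; exact: bigmin_le_cond.
have t0 : 0 <= t.
  by apply: le_bigmin => //; rewrite le_min !ltW.
pose f' k := f k - (if k == i then t else 0).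
pose g' k := g k - (if k == j then t else 0).
have f'0 k : 0 <= f' k.
  by rewrite /f'; case: eqP => [->|_]; rewrite ?subr0 // subr_ge0.
have g'0 k : 0 <= g' k.
  by rewrite /g'; case: eqP => [->|_]; rewrite ?subr0 // subr_ge0.
have sumf' (C : {set I}) : \sum_(k in C) f' k =
    \sum_(k in C) f k - (if i \in C then t else 0).
  rewrite big_split/= sumrN -big_mkcondr/=; congr (_ - _).
  rewrite (eq_bigl (fun k => (k == i) && (i \in C))); last first.
    by move=> k; case: eqP => [->|_]; rewrite ?andbT ?andbF.
  by case: (i \in C); [rewrite (eq_bigl _ _ (fun _ => andbT _)) big_pred1_eq
                      |rewrite big_pred0// => k; rewrite andbF].
have sumg' (C : {set J}) : \sum_(k in C) g' k =
    \sum_(k in C) g k - (if j \in C then t else 0).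
  rewrite big_split/= sumrN -big_mkcondr/=; congr (_ - _).
  rewrite (eq_bigl (fun k => (k == j) && (j \in C))); last first.
    by move=> k; case: eqP => [->|_]; rewrite ?andbT ?andbF.
  by case: (j \in C); [rewrite (eq_bigl _ _ (fun _ => andbT _)) big_pred1_eq
                      |rewrite big_pred0// => k; rewrite andbF].
have H' : hall_condition f' g'.
  move=> C; rewrite sumf' sumg'; have [iC|iC] := boolP (i \in C).
    have -> : j \in neighbours C.
      by rewrite inE; apply/existsP; exists i; rewrite iC.
    by rewrite lerD2r.
  have [jC|jC] := boolP (j \in neighbours C); last by rewrite !subr0.
  have := t_slack C; rewrite /crit iC jC => /(_ isT); rewrite /slack.
  by rewrite subr0 !lerBrDr addrC.
have f'z k : f k = 0 -> f' k = 0.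
  by move=> fk; apply/eqP; rewrite eq_le f'0 andbT /f' fk;
     case: ifP => _; rewrite sub0r oppr_le0.
have g'z k : g k = 0 -> g' k = 0.
  by move=> fk; apply/eqP; rewrite eq_le g'0 andbT /g' fk;
     case: ifP => _; rewrite sub0r oppr_le0.
suff [K' cK'] : exists K, coupling f' g' K.
  exists (fun k l => (if (k == i) && (l == j) then t else 0) + K' k l).
  apply: (@coupling_sum (fun k => if k == i then t else 0) f' _
            (fun k => if k == j then t else 0) g') => //.
  - split=> [k l|k l|k|l].
    + by case: ifP.
    + by case: ifP => // /andP[/eqP -> /eqP ->]; rewrite rij.
    + case: eqP => _ /=; last by rewrite big1.
      by rewrite -big_mkcond big_pred1_eq.
    + under eq_bigr do rewrite andbC.
      case: eqP => _ /=; last by rewrite big1.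
      by rewrite -big_mkcond big_pred1_eq.
  - by move=> k; rewrite /f' addrC subrK.
  - by move=> k; rewrite /g' addrC subrK.
have [fi'|fi'] := eqVneq (f' i) 0.
  apply: IH => //; apply: leq_trans le_n.
  have := supp_lt f'z fi fi'; have := supp_le g'z.
  by move=> ? ?; rewrite -addSn leq_add.
have [gj'|gj'] := eqVneq (g' j) 0.
  apply: IH => //; apply: leq_trans le_n.
  have := supp_lt g'z gj gj'; have := supp_le f'z.
  by move=> ? ?; rewrite -addnS leq_add.
(* Neither weight has vanished, so the minimum [t] is the slack of a critical set. *)
have [C cC tight] : exists2 C, crit C & slack C = t.
  have : t < Order.min (f i) (g j).
    rewrite lt_neqAle t_le andbT; apply/eqP => tE.
    move: fi' gj'; rewrite /f' /g' !eqxx tE.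
    by case: (leP (f i) (g j)); rewrite subrr eqxx.
  rewrite /t; elim/big_ind : _ => [|x y hx hy|C cC _]; last by exists C.
  - by rewrite ltxx.
  - by case: (leP x y).
have /andP[iC jC] := cC.
have tight' : \sum_(k in C) f' k = \sum_(k in neighbours C) g' k.
  rewrite sumf' sumg' (negbTE iC) jC -tight /slack; lra.
(* The problem splits: [C] against its neighbours, and the complement of [C] against the remaining
   vertices. *)
pose fC k := if k \in C then f' k else 0.
pose gC k := if k \in neighbours C then g' k else 0.
pose fD k := if k \in ~: C then f' k else 0.
pose gD k := if k \in ~: neighbours C then g' k else 0.
have [K1 cK1] : exists K, coupling fC gC K.
  apply: IH.
  - have l1 : (supp fC < supp f)%N.
      apply: (@supp_lt _ _ _ i) => //; last by rewrite /fC (negbTE iC).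
      by move=> k /f'z; rewrite /fC => ->; rewrite if_same.
    have l2 : (supp gC <= supp g)%N.
      by apply: supp_le => k /g'z; rewrite /gC => ->; rewrite if_same.
    by apply: leq_trans le_n; rewrite -addSn leq_add.
  - by move=> k; rewrite /fC; case: ifP.
  - by move=> k; rewrite /gC; case: ifP.
  - move=> D; rewrite !sum_restrict; apply: le_trans (H' _) _.
    rewrite -[leRHS](@sum_restrict _ g' _ _) big_mkcond [leRHS]big_mkcond.
    apply: ler_sum => k _; have [kDC|_] := ifPn; last by case: ifP => // _; case: ifP.
    have : k \in neighbours (D :&: C) by [].
    rewrite inE => /existsP[l /andP[]]; rewrite inE => /andP[lD lC] rlk.
    have -> : k \in neighbours D by rewrite inE; apply/existsP; exists l; rewrite lD.
    have -> // : k \in neighbours C by rewrite inE; apply/existsP; exists l; rewrite lC.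
have [K2 cK2] : exists K, coupling fD gD K.
  apply: IH.
  (* [C] carries mass: by tightness its [f']-mass is the [g']-mass of [neighbours C], which contains
     [j] with [g' j != 0]. Hence [fD] has a smaller support. *)
  - have [l lC fl] : exists2 l, l \in C & f' l != 0.
      apply/exists_inP/negbNE; rewrite negb_exists_in; apply/negP => /forallP fz.
      have : \sum_(k in C) f' k = 0.
        by apply: big1 => k kC; have := fz k; rewrite kC negbK => /eqP.
      rewrite tight' => /eqP; rewrite psumr_eq0// => /allP/(_ j).
      by rewrite mem_index_enum jC (negbTE gj') => /(_ isT).
    have l1 : (supp fD < supp f)%N.
      apply: (@supp_lt _ _ _ l) => //.
      - by move=> k /f'z; rewrite /fD => ->; rewrite if_same.
      - by apply: contraNneq fl => /f'z ->.
      - by rewrite /fD inE lC.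
    have l2 : (supp gD <= supp g)%N.
      by apply: supp_le => k /g'z; rewrite /gD => ->; rewrite if_same.
    by apply: leq_trans le_n; rewrite -addSn leq_add.
  - by move=> k; rewrite /fD; case: ifP.
  - by move=> k; rewrite /gD; case: ifP.
  - move=> D; rewrite !sum_restrict.
    (* Hall's condition for the union, minus the tight equality for [C]. *)
    have := H' (C :|: D); rewrite neighboursU.
    rewrite (big_setID C)/= finset.setUK finset.setDUl finset.setDv finset.set0U -finset.setDE.
    rewrite (big_setID (neighbours C))/= finset.setUK finset.setDUl finset.setDv finset.set0U.
    by rewrite tight' lerD2l -finset.setDE.
exists (fun k l => K1 k l + K2 k l).
apply: (coupling_sum cK1 cK2) => k.
  by rewrite /fC /fD inE; case: (k \in C); rewrite ?addr0 ?add0r.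
by rewrite /gC /gD finset.in_setC; case: (k \in neighbours C); rewrite ?addr0 ?add0r.
Qed.

End WeightedHall.

(** The deficits [g j - \sum_i K i j] are nonnegative and sum to zero. *)
Lemma coupling_marginal (R : realFieldType) (I J : finType) (r : I -> J -> bool)
    (f : I -> R) (g : J -> R) K :
  coupling r f g K -> \sum_i f i = \sum_j g j -> forall j, \sum_i K i j = g j.
Proof.
move=> [_ _ Kf Kg] fg j.
have : \sum_j (g j - \sum_i K i j) = 0.
  rewrite big_split/= sumrN exchange_big/=.
  by under [X in _ - X]eq_bigr do rewrite Kf; rewrite fg subrr.
move=> /psumr_eq0P h; apply/esym/eqP; rewrite -subr_eq0.
by rewrite h// => k _; rewrite subr_ge0.
Qed.

(** * One fibre, and tensorization over fibres *)

Section Tensor.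
Context {R : realFieldType} {X O J : finType} (r : X -> O -> J -> bool).
Variables (f : X -> R) (g : J -> R).
Hypotheses (f_ge0 : forall x, 0 <= f x) (g_ge0 : forall j, 0 <= g j).

Lemma sum_tuple_nil (T : finType) (F : 0.-tuple T -> R) :
  \sum_t F t = F [tuple].
Proof.
by rewrite (big_pred1 [tuple])// => t /=; apply/esym/eqP; exact: tuple0.
Qed.

Lemma sum_tuple_cons (T : finType) n (F : n.+1.-tuple T -> R) :
  \sum_t F t = \sum_x \sum_(t : n.-tuple T) F [tuple of x :: t].
Proof.
rewrite pair_big (reindex (fun q : T * n.-tuple T => [tuple of q.1 :: q.2]))//=.
exists (fun t : n.+1.-tuple T => (thead t, [tuple of behead t])) => [[x t] _|t _] /=.
  by rewrite theadE; congr pair; exact: val_inj.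
by rewrite [RHS]tuple_eta.
Qed.

Hypothesis game : forall U : pred J,
  \sum_(x | [exists o, [forall j, r x o j ==> U j]]) f x <= \sum_(j | U j) g j.

(* The adversary choosing the [o]'s is even allowed to see the outcome of the
   other coordinates. *)
Lemma game_tensor n (W : pred (n.-tuple X)) (U : pred (n.-tuple J)) :
  (forall xs, W xs -> exists os : n.-tuple O, forall zs,
    (forall i, r (tnth xs i) (tnth os i) (tnth zs i)) -> U zs) ->
  \sum_(xs | W xs) \prod_(x <- xs) f x <= \sum_(zs | U zs) \prod_(j <- zs) g j.
Proof.
elim: n W U => [|n IH] W U WU; rewrite big_mkcond [leRHS]big_mkcond.
  rewrite !sum_tuple_nil !big_nil; have [W0|W0] := boolP (W [tuple]).
    by have [os -> //] := WU _ W0; case.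
  by case: ifP.
rewrite !sum_tuple_cons.
(* The event that, once the tail [zs] is known, the first coordinate [x] can still be won. The
   induction hypothesis, with [x] fixed, trades the tail of [xs] for [zs]; then [game], with [zs]
   fixed, trades [x] for [j]. *)
pose Ux x (zs : n.-tuple J) :=
  [exists o, [forall j, r x o j ==> U [tuple of j :: zs]]].
have stepx x : \sum_(t : n.-tuple X)
    (if W [tuple of x :: t] then \prod_(y <- [tuple of x :: t]) f y else 0) <=
    f x * \sum_(zs | Ux x zs) \prod_(j <- zs) g j.
  rewrite -big_mkcond/=; under eq_bigr do rewrite big_cons.
  rewrite -mulr_sumr ler_wpM2l//; apply: IH => xs /WU [os Uos].
  exists [tuple of behead os] => zs rzs.
  apply/existsP; exists (thead os); apply/forallP => j; apply/implyP => rj.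
  apply: Uos => i; rewrite [os]tuple_eta.
  case: (unliftP ord0 i) => [k ->|->]; last by rewrite !tnth0.
  by have := rzs k; rewrite !tnthS.
apply: (le_trans (ler_sum _ (fun x _ => stepx x))).
under eq_bigr do rewrite big_mkcond mulr_sumr.
rewrite exchange_big [leRHS]exchange_big /=; apply: ler_sum => zs _.
have g_zs : 0 <= \prod_(j <- zs) g j by apply: prodr_ge0.
have := ler_wpM2r g_zs (game (fun j => U [tuple of j :: zs])).
rewrite !mulr_suml big_mkcond [leRHS]big_mkcond/=.
congr (_ <= _); apply: eq_bigr => j _; last by rewrite big_cons.
by rewrite /Ux; case: ifP; rewrite ?mulr0.
Qed.
End Tensor.

Section OneFibre.
Context {R : realFieldType} (p : R) {V : finType}.
Hypotheses (p_ge0 : 0 <= p) (p_le1 : p <= 1).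

Definition bern (b : bool) : R := if b then p else 1 - p.

Lemma bern_ge0 b : 0 <= bern b. Proof. by case: b; rewrite // subr_ge0. Qed.

Lemma sum_bern : \sum_b bern b = 1.
Proof. by rewrite big_bool/= addrC subrK. Qed.

(** Once the constraint is moved into the factors, the sum of products becomes a product of sums,
    and each free coordinate contributes 1. *)
Lemma bern_marginal (T : finType) (D : pred T) (u : T -> bool) :
  \sum_(z : {ffun T -> bool} | [forall v, D v ==> (z v == u v)])
    \prod_v bern (z v) = \prod_(v | D v) bern (u v).
Proof.
rewrite big_mkcond [RHS]big_mkcond /=.
transitivity (\sum_(z : {ffun T -> bool})
    \prod_v (if D v ==> (z v == u v) then bern (z v) else 0)).
  apply: eq_bigr => z _; case: ifPn => [/forallP Dz|].
    by apply: eq_bigr => v _; rewrite Dz.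
  rewrite negb_forall => /existsP[v Dv].
  by rewrite (bigD1 v)//= (negbTE Dv) mul0r.
rewrite -(bigA_distr_bigA (fun v b => if D v ==> (b == u v) then bern b else 0)).
apply: eq_bigr => v _; case: (D v) => /=; last exact: sum_bern.
by rewrite -big_mkcond big_pred1_eq.
Qed.

(* [x] and [xd] are the bits of a point of [B], [y] and [yd] the Z-bits at
   the two chosen points of its fibre. *)
Definition allowed (x xd y yd : bool) :=
  if x then y && (xd ==> yd) else xd ==> y || yd.

(* [None] means that the chosen point is outside of the finite window [V];
   then nothing is asked. *)
Definition compat (x : bool * bool) (o : option V * option V)
    (z : {ffun V -> bool}) :=
  if (o.1, o.2) is (Some s, Some sd) then
    (s != sd) ==> allowed x.1 x.2 (z s) (z sd) else true.

Let g (z : {ffun V -> bool}) := \prod_v bern (z v).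

Let g_ge0 z : 0 <= g z. Proof. by apply: prodr_ge0 => v _; exact: bern_ge0. Qed.

Let sum_g : \sum_z g z = 1.
Proof.
have := bern_marginal (@pred0 V) xpred0; rewrite big_pred0//.
by under eq_bigl do rewrite (introT forallP (fun _ => isT)).
Qed.

Let prob_le (U U' : pred {ffun V -> bool}) : (forall z, U z -> U' z) ->
  \sum_(z | U z) g z <= \sum_(z | U' z) g z.
Proof.
move=> UU'; rewrite big_mkcond [leRHS]big_mkcond; apply: ler_sum => z _.
by case: ifPn => [/UU' ->//|_]; case: ifP.
Qed.

Let prob_and s : \sum_(z : {ffun V -> bool} | z s) g z = p.
Proof.
have := bern_marginal (pred1 s) xpredT; rewrite big_pred1_eq /bern => <-.
apply: eq_bigl => z; apply/idP/forallP => [zs v|/(_ s)]; rewrite /= ?eqxx.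
  by apply/implyP => /eqP ->; rewrite zs.
by move=> /eqP.
Qed.

Let prob_and2 s sd : s != sd -> \sum_(z : {ffun V -> bool} | z s && z sd) g z = p * p.
Proof.
move=> ssd; rewrite -/(bern true).
 have := bern_marginal (pred2 s sd) xpredT.
rewrite (bigD1 s)/= ?eqxx// (big_pred1 sd) => [<-|v]; last first.
  by case: (eqVneq v s) => [->|_] /=; rewrite ?(negbTE ssd)// andbT.
apply: eq_bigl => z; apply/andP/forallP => [[zs zd] v|h].
  by apply/implyP => /orP[] /eqP ->; rewrite ?zs ?zd.
by have := h s; have := h sd; rewrite /= !eqxx orbT /= => /eqP -> /eqP ->.
Qed.

Let prob_or s sd : s != sd ->
  \sum_(z : {ffun V -> bool} | z s || z sd) g z = 1 - (1 - p) * (1 - p).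
Proof.
move=> ssd; have := bern_marginal (pred2 s sd) xpred0.
rewrite (bigD1 s)/= ?eqxx// (big_pred1 sd) => [|v]; last first.
  by case: (eqVneq v s) => [->|_] /=; rewrite ?(negbTE ssd)// andbT.
have := sum_g; rewrite (bigID (fun z : {ffun V -> bool} => z s || z sd))/=.
rewrite [X in _ + X = _ -> _](eq_bigl (fun z : {ffun V -> bool} =>
    [forall v, pred2 s sd v ==> (z v == false)])) => [|z].
  by rewrite /g => + e; rewrite {}e /bern; lra.
rewrite negb_or; apply/andP/forallP => [[zs zd] v|h].
  by apply/implyP => /orP[] /eqP ->; rewrite ?(negbTE zs) ?(negbTE zd).
by have := h s; have := h sd; rewrite /= !eqxx orbT /= => /eqP -> /eqP ->.
Qed.

Let win (U : pred {ffun V -> bool}) x xd :=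
  [exists o, [forall z, compat (x, xd) o z ==> U z]].

(* The four outcomes are ordered 00 > 01 > 10 > 11 by how hard they are to
   win; winning one of them bounds the probability of [U] from below by the
   mass of this outcome and of all the easier ones. *)
Lemma fibre_game (U : pred {ffun V -> bool}) :
  \sum_(x | [exists o, [forall z, compat x o z ==> U z]])
    bern x.1 * bern x.2 <= \sum_(z | U z) \prod_v bern (z v).
Proof.
change (\sum_(x | [exists o, [forall z, compat x o z ==> U z]])
  bern x.1 * bern x.2 <= \sum_(z | U z) g z).
(* A choice outside of [V], or two equal choices, asks nothing of [z]; winning with it forces [U] to
   be the whole space. *)
have win_inv x xd : win U x xd -> \sum_(z | U z) g z = 1 \/
    exists s sd : V, s != sd /\
      forall z : {ffun V -> bool}, allowed x xd (z s) (z sd) -> U z.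
  move=> /existsP[[[s|] [sd|]] /forallP h]; rewrite /compat/= in h; last 3 first.
  - by left; rewrite (eq_bigl xpredT).
  - by left; rewrite (eq_bigl xpredT).
  - by left; rewrite (eq_bigl xpredT).
  have [ssd|ssd] := eqVneq s sd.
    by left; rewrite (eq_bigl xpredT)// => z; have := h z; rewrite ssd eqxx.
  by right; exists s, sd; split=> // z; have := h z; rewrite ssd /= => /implyP.
have U_ge0 : 0 <= \sum_(z | U z) g z by apply: sumr_ge0.
have pp : 0 <= p * (1 - p) by rewrite mulr_ge0// subr_ge0.
have qq : 0 <= (1 - p) * (1 - p) by rewrite mulr_ge0// subr_ge0.
have p2 : 0 <= p * p by rewrite mulr_ge0.
(* The four bounds are cumulative masses: [p * p] is that of 11, [p] adds 10,
   [1 - (1 - p) * (1 - p)] adds 01, and 1 adds 00. *)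
have w00 : win U false false -> 1 <= \sum_(z | U z) g z.
  move=> /win_inv[->//|[s [sd [_ h]]]].
  by rewrite (eq_bigl xpredT) ?sum_g// => z; rewrite h.
have w01 : win U false true -> 1 - (1 - p) * (1 - p) <= \sum_(z | U z) g z.
  move=> /win_inv[->|[s [sd [ssd h]]]]; first lra.
  by rewrite -(prob_or ssd); exact: prob_le.
have w10 : win U true false -> p <= \sum_(z | U z) g z.
  move=> /win_inv[->//|[s [sd [ssd h]]]].
  rewrite -(prob_and s); apply: prob_le => z zs; apply: h.
  by rewrite /allowed zs.
have w11 : win U true true -> p * p <= \sum_(z | U z) g z.
  move=> /win_inv[->|[s [sd [ssd h]]]]; first by rewrite mulr_ile1.
  by rewrite -(prob_and2 ssd); exact: prob_le.
have -> : \sum_(x | [exists o, [forall z, compat x o z ==> U z]])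
    bern x.1 * bern x.2 =
    \sum_x \sum_xd (if win U x xd then bern x * bern xd else 0).
  by rewrite pair_big big_mkcond; apply: eq_bigr => -[].
rewrite !big_bool /bern /=.
move: w00 w01 w10 w11.
case: (win U false false) => [/(_ isT) ?|_];
case: (win U false true) => [/(_ isT) ?|_];
case: (win U true false) => [/(_ isT) ?|_];
case: (win U true true) => [/(_ isT) ?|_]; lra.
Qed.

End OneFibre.

(** * Finitely additive joint laws *)

Section Prefixes.

(* The most recent bit comes first. *)
Fixpoint prefix_of (n : nat) (z : nat -> bool) : seq bool :=
  if n is m.+1 then z m :: prefix_of m z else [::].

Definition cylinder (c : seq bool) : set (nat -> bool) :=
  [set z | prefix_of (size c) z = c].

Lemma size_prefix_of n z : size (prefix_of n z) = n.
Proof. by elim: n => //= n ->. Qed.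

Lemma cylinder_split c : cylinder c = cylinder (true :: c) `|` cylinder (false :: c).
Proof.
rewrite /cylinder; apply/seteqP; split => z /=; last by case=> -[_ h].
by move=> ->; case: (z (size c)); [left|right].
Qed.

Lemma cylinder_disj c : cylinder (true :: c) `&` cylinder (false :: c) = set0.
Proof. by rewrite /cylinder; apply/seteqP; split => z // [] /= [-> _] []. Qed.

Lemma eq_prefix_of n (z z' : nat -> bool) :
  prefix_of n z = prefix_of n z' -> forall i, (i < n)%N -> z i = z' i.
Proof.
elim: n => //= n IH [zn /IH h] i; rewrite ltnS leq_eqVlt => /orP[/eqP ->//|].
exact: h.
Qed.

End Prefixes.

Section JointContent.
Context d (T : measurableType d) (R : realType) (P : probability T R).

(* Plays the role of the joint law of a point of [T] with law [P] and of a
   random bit sequence, but is only finitely additive. *)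
Record joint_content := JointContent {
  jc :> set T -> set (nat -> bool) -> R ;
  jc_ge0 : forall E Q, 0 <= jc E Q ;
  jc_setT : forall E, measurable E -> jc E setT = fine (P E) ;
  jc_addl : forall E E' Q, measurable E -> measurable E' ->
    E `&` E' = set0 -> jc (E `|` E') Q = jc E Q + jc E' Q ;
  jc_addr : forall E Q Q', measurable E ->
    Q `&` Q' = set0 -> jc E (Q `|` Q') = jc E Q + jc E Q' }.

Variable M : joint_content.

Lemma jc_set0l Q : M set0 Q = 0.
Proof.
have := jc_addl M Q (@measurable0 _ T) (@measurable0 _ T) (setI0 set0).
by rewrite setU0 => h; lra.
Qed.

Lemma jc_set0r E : measurable E -> M E set0 = 0.
Proof. by move=> mE; have := jc_addr M mE (setI0 set0); rewrite setU0 => h; lra. Qed.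

Lemma jc_le_prob E Q : measurable E -> M E Q <= fine (P E).
Proof.
move=> mE; rewrite -(jc_setT M mE) -(setUv Q) jc_addr ?setICr//.
by rewrite lerDl jc_ge0.
Qed.

Definition jc_measure (Q : set (nat -> bool)) (E : set T) : \bar R := (M E Q)%:E.

(** Finite additivity peels off the first [n] sets; countable additivity thus reduces to letting the
    remainder tend to 0. *)
Lemma jc_tail (F : nat -> set T) Q n : (forall i, measurable (F i)) ->
  trivIset setT F ->
  M (\bigcup_i F i) Q = \sum_(0 <= i < n) M (F i) Q +
                        M (\bigcup_(i in [set i | (n <= i)%N]) F i) Q.
Proof.
move=> mF tF; elim: n => [|n ->].
  rewrite big_geq// add0r; congr (M _ Q).
  by apply/seteqP; split => x [i _ Fi]; exists i.
rewrite big_nat_recr//= -addrA; congr (_ + _).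
rewrite -jc_addl//.
- congr (M _ Q); apply/seteqP; split => x /=.
    move=> [i /= ]; rewrite leq_eqVlt => /orP[/eqP <-|ni] Fi; first by left.
    by right; exists i.
  by move=> [Fn|[i /= ni Fi]]; [exists n => /=|exists i => //=; exact: ltnW].
- by apply: bigcup_measurable.
- apply/seteqP; split => // x [Fn [i /= ni Fi]].
  have := tF n i I I; move=> /(_ (ex_intro _ x (conj Fn Fi))) e.
  by rewrite e ltnn in ni.
Qed.

Let jc_measure0 Q : jc_measure Q set0 = 0%E.
Proof. by rewrite /jc_measure jc_set0l. Qed.

Let jc_measure_ge0 Q E : (0 <= jc_measure Q E)%E.
Proof. by rewrite lee_fin jc_ge0. Qed.

(* Domination by the countably additive [P] forces countable additivity. *)
Let jc_sigma_additive Q : semi_sigma_additive (jc_measure Q).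
Proof.
move=> F mF tF mUF; rewrite /jc_measure.
under eq_fun do rewrite sumEFin.
apply: cvg_EFin; first exact: nearW.
(* This is the [P]-mass of the remainder, which tends to 0, and it bounds the remainder for every
   [Q]. *)
pose tail n := M (\bigcup_(i in [set i | (n <= i)%N]) F i) setT.
have tail0 : tail n @[n --> \oo] --> (0 : R).
  rewrite -(subrr (M (\bigcup_i F i) setT)).
  rewrite (_ : (fun n => tail n) = (fun n => M (\bigcup_i F i) setT -
     \sum_(0 <= i < n) M (F i) setT)); last first.
    by apply/funext => n; rewrite (jc_tail setT n mF tF) addrC addKr.
  apply: cvgB; first exact: cvg_cst.
  rewrite jc_setT//.
  apply: (@cvg_trans _ (fine (\sum_(0 <= i < n) P (F i))%E @[n --> \oo])).
    apply: near_eq_cvg; near=> n; rewrite -sum_fine.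
      by apply: eq_bigr => i _; rewrite jc_setT.
    by move=> i _; exact: fin_num_measure.
  apply: fine_cvg; rewrite fineK ?fin_num_measure//.
  exact: (@measure_semi_sigma_additive _ _ _ P F mF tF mUF).
apply: (@squeeze_cvgr _ _ _ _ (fun n => M (\bigcup_i F i) Q - tail n)
                              (fun n => M (\bigcup_i F i) Q)).
- near=> n; rewrite /= (jc_tail Q n mF tF) lerDl jc_ge0 andbT.
  rewrite lerBlDr lerD2l /tail.
  have mt : measurable (\bigcup_(i in [set i | (n <= i)%N]) F i).
    by apply: bigcup_measurable.
  by rewrite (jc_setT M mt) jc_le_prob.
- by rewrite -[X in _ --> X]subr0; apply: cvgB => //; exact: cvg_cst.
- exact: cvg_cst.
Unshelve. all: by end_near. Qed.

HB.instance Definition _ Q := isMeasure.Build _ _ _ (jc_measure Q)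
  (jc_measure0 Q) (@jc_measure_ge0 Q) (@jc_sigma_additive Q).

Let jc_finite Q : fin_num_fun (jc_measure Q).
Proof. by []. Qed.

HB.instance Definition _ Q := Measure_isFinite.Build _ _ _ (jc_measure Q)
  (@jc_finite Q).

(** Domination by [P] gives absolute continuity, hence a Radon-Nikodym density; it is finite
    everywhere, so [fine] loses nothing. *)
Lemma jc_density Q : exists k : T -> R,
  [/\ forall w, 0 <= k w, measurable_fun setT k &
      forall E, measurable E -> (\int[P]_(w in E) (k w)%:E)%E = (M E Q)%:E].
Proof.
have [|f [f0 ffin fint fE]] := @radon_nikodym_sigma_finite _ _ _ P (jc_measure Q).
  apply/null_content_dominatesP => E mE PE0.
  rewrite /jc_measure; congr EFin; apply/eqP; rewrite eq_le jc_ge0 andbT.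
  by rewrite (le_trans (jc_le_prob Q mE))// PE0.
have mf := measurable_int _ fint.
exists (fine \o f); split => [w||E mE] /=.
- by rewrite fine_ge0.
- apply/measurable_EFinP; rewrite (_ : _ \o _ = f)//.
  by apply/funext => w /=; rewrite fineK.
- by under eq_integral do rewrite fineK//; rewrite -fE.
Qed.

End JointContent.

(** * Sampling the bits from a uniform variable *)

Lemma ae_forall_count d (T : measurableType d) (R : realType)
    (mu : {measure set T -> \bar R}) (I : countType) (Q : I -> T -> Prop) :
  (forall i, {ae mu, forall w, Q i w}) -> {ae mu, forall w, forall i, Q i w}.
Proof.
move=> aeQ; have : {ae mu, forall w, forall n,
    if @pickle_inv I n is Some i then Q i w else True}.
  by apply: ae_foralln => n; case: pickle_inv => [i|]; [exact: aeQ|exact: aeW].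
by apply: filterS => w h i; have := h (choice.pickle i); rewrite pickleK_inv.
Qed.

(** Only the trace of [A] on [[0, 1[] is prescribed: the uniform law lives on the closed interval,
    and its extra point 1 is null. *)
Lemma uniform01E (R : realType) (A : set R) (l k : R) : measurable A ->
  0 <= l -> 0 <= k -> l + k <= 1 -> A `&` `[0, 1[ = `[l, l + k[%classic ->
  uniform_prob (@ltr01 R) A = k%:E.
Proof.
move=> mA l0 k0 lk1 Alk.
have m01 : measurable (`[0, 1[%classic : set R) by exact: measurable_itv.
have mc : measurable (~` `[0, 1[%classic : set R) by exact: measurableC.
have U01 : uniform_prob (@ltr01 R) (~` `[0, 1[%classic) = 0%E.
  rewrite /uniform_prob integral_uniform_pdf.
  rewrite (_ : _ `&` _ = [set 1]) ?integral_set1//.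
  apply/seteqP; split => u /=; rewrite !in_itv/=.
    by move=> [/negP nu /andP[u0 u1]]; apply/eqP; rewrite eq_le u1/=; lra.
  by move=> ->; split; [apply/negP|]; lra.
rewrite -(setIT A) -(setUv `[0, 1[%classic) setIUr measureU//=; last 3 first.
- exact: measurableI.
- exact: measurableI.
- by rewrite setIACA setICr setI0.
rewrite [X in (_ + X)%E](_ : _ = 0%E) ?adde0; last first.
  apply/eqP; rewrite eq_le measure_ge0 andbT -U01; apply: le_measure => //.
    by apply/mem_set; exact: measurableI.
  exact/mem_set.
rewrite Alk /uniform_prob.
rewrite (eq_integral (cst 1%E)); last first.
  move=> u /set_mem; rewrite /= in_itv/= => /andP[lu ul].
  by rewrite /uniform_pdf subr0 invr1 ifT//; lra.
rewrite integral_cst//= mul1e lebesgue_measure_itv/= lte_fin.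
case: ifPn => [_|]; first by rewrite -EFinD addrC addKr.
by rewrite -leNgt => h; congr EFin; lra.
Qed.

Section Realization.
Context d (T : measurableType d) (R : realType) (P : probability T R).
Variable M : joint_content P.

(** A version of the conditional probability, given the point of [T], that the bits start with
    [c]. *)
Let k (c : seq bool) : T -> R := sval (cid (jc_density M (cylinder c))).

Let k_ge0 c w : 0 <= k c w.
Proof. by rewrite /k; case: cid => f /= [? ? ?]; auto. Qed.

Let k_meas c : measurable_fun setT (k c).
Proof. by rewrite /k; case: cid => f /= [? ? ?]; auto. Qed.

Let k_int c E : measurable E ->
  (\int[P]_(w in E) (k c w)%:E)%E = (M E (cylinder c))%:E.
Proof. by rewrite /k; case: cid => f /= [? ? ?]; auto. Qed.

Let kE_meas c : measurable_fun setT (EFin \o k c).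
Proof. exact/measurable_EFinP. Qed.

Let k_integrable c : P.-integrable setT (EFin \o k c).
Proof.
apply/integrableP; split; first exact: kE_meas.
under eq_integral do rewrite /= ger0_norm//.
by rewrite k_int// ltry.
Qed.

Let k_nil : {ae P, forall w, k [::] w = 1}.
Proof.
have : ae_eq P setT (EFin \o k [::]) (cst 1%E).
  apply: integral_ae_eq => // E _ mE.
  rewrite k_int// integral_cst// mul1e (_ : cylinder [::] = setT); last first.
    by apply/seteqP; split.
  by rewrite jc_setT// fineK// fin_num_measure.
by apply: filterS => w /(_ I) /= [].
Qed.

(** Both sides have the same integral over every measurable set; one null set serves all [c], since
    there are countably many finite words. *)
Let k_split : {ae P, forall w c, k c w = k (true :: c) w + k (false :: c) w}.
Proof.
apply: ae_forall_count => c.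
have : ae_eq P setT (EFin \o k c)
    (fun w => (k (true :: c) w)%:E + (k (false :: c) w)%:E)%E.
  apply: integral_ae_eq => // [|E _ mE].
    by apply: emeasurable_funD; exact: kE_meas.
  rewrite ge0_integralD//; last 4 first.
  - by move=> w _; rewrite lee_fin.
  - exact: measurable_funTS (kE_meas _).
  - by move=> w _; rewrite lee_fin.
  - exact: measurable_funTS (kE_meas _).
  by rewrite !k_int// cylinder_split jc_addr ?cylinder_disj.
by apply: filterS => w /(_ I) /= [].
Qed.

Fixpoint left_end (c : seq bool) (w : T) : R :=
  if c is b :: c' then left_end c' w + (if b then k (false :: c') w else 0)
  else 0.

(* The nested intervals [left_end c w, left_end c w + k c w[ form a binary
   tree of partitions of [0, 1[. *)
Fixpoint code (n : nat) (x : T * R) : seq bool :=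
  if n is m.+1 then
    (left_end (code m x) x.1 + k (false :: code m x) x.1 <= x.2) :: code m x
  else [::].

Definition decode (n : nat) (x : T * R) : bool := head false (code n.+1 x).

Lemma code_prefix n x : code n x = prefix_of n (decode^~ x).
Proof. by elim: n => //= n <-. Qed.

Let left_end_meas c : measurable_fun setT (left_end c).
Proof.
elim: c => [|b c IH]; first exact: measurable_cst.
by apply: measurable_funD => //; case: b => //; exact: measurable_cst.
Qed.

Lemma code_meas n c : measurable [set x | code n x = c].
Proof.
elim: n c => [|n IH] c.
  case: c => [|b c]; first by rewrite (_ : [set _ | _] = setT)//; apply/seteqP.
  by rewrite (_ : [set _ | _] = set0)//; apply/seteqP; split.
case: c => [|b c].
  by rewrite (_ : [set _ | _] = set0)//; apply/seteqP; split.
(* On the event [code n x = c] the threshold can be computed with the fixed word [c], which makes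
   the comparison measurable. *)
pose f (x : T * R) : bool := left_end c x.1 + k (false :: c) x.1 <= x.2.
rewrite (_ : [set _ | _] = [set x | code n x = c] `&` f @^-1` [set b]).
  apply: measurableI => //; rewrite -[X in measurable X]setTI.
  have : measurable_fun setT f.
    apply: measurable_fun_ler => //; apply: measurable_funD.
      exact: (measurableT_comp (left_end_meas c)).
    exact: (measurableT_comp (k_meas _)).
  by move=> /(_ measurableT); exact.
apply/seteqP; split => x /=; first by move=> [fx cx]; rewrite -fx /f cx.
by move=> [cx fx]; rewrite /f -cx in fx; rewrite fx cx.
Qed.

(** At these points, which are almost all by [k_nil] and [k_split], the intervals nest exactly and
    fill [[0, 1[]. *)
Definition good (w : T) :=
  k [::] w = 1 /\ forall c, k c w = k (true :: c) w + k (false :: c) w.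

Let good_bounds w c : good w -> 0 <= left_end c w /\ left_end c w + k c w <= 1.
Proof.
move=> [k1 ks]; elim: c => [|b c [h0 h1]] /=; first by rewrite add0r k1.
have := ks c; have := k_ge0 (true :: c) w; have := k_ge0 (false :: c) w.
by case: b; split; lra.
Qed.

Let good_code w c u : good w -> 0 <= u < 1 ->
  (code (size c) (w, u) == c) = (left_end c w <= u < left_end c w + k c w).
Proof.
move=> [k1 ks] u01; elim: c => [|b c IH] /=; first by rewrite add0r k1 u01.
have := ks c; have := k_ge0 (true :: c) w; have := k_ge0 (false :: c) w.
move=> kf kt kc; rewrite eqseq_cons.
have [cE|cE] := eqVneq (code (size c) (w, u)) c; rewrite ?andbT ?andbF.
  rewrite cE in IH *; move: IH; rewrite eqxx => /esym/andP[lu ul].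
  case: b; rewrite ?eqb_id.
    have [h|h] := lerP (left_end c w + k (false :: c) w) u => //=.
    by apply/esym; lra.
  rewrite addr0 lu/= eqbF_neg -ltNge.
  by [].
move: IH; rewrite (negbTE cE) => IH; apply/esym/negbTE/negP => /andP[h1 h2].
suff : left_end c w <= u < left_end c w + k c w by rewrite -IH.
by case: b h1 h2 => h1 h2; lra.
Qed.

Let U := uniform_prob (@ltr01 R).

Let code_unif w c : good w ->
  U [set u | code (size c) (w, u) = c] = (k c w)%:E.
Proof.
move=> gw; have [l0 l1] := good_bounds c gw.
have -> : [set u | code (size c) (w, u) = c] =
    xsection [set x | code (size c) x = c] w.
  by apply/seteqP; split => u; rewrite /xsection/=; [move=> ?; apply/mem_set|move/set_mem].
apply: (uniform01E _ l0 (k_ge0 c w) l1).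
  exact: measurable_xsection (code_meas _ _).
apply/seteqP; split => u; rewrite /xsection/= !in_itv/=.
  by move=> [/set_mem /= /eqP + u01]; rewrite good_code.
move=> /andP[lu ul]; have u01 : 0 <= u < 1.
  by rewrite (le_trans l0 lu) (lt_le_trans ul l1).
by split=> //; apply/mem_set/eqP; rewrite good_code// lu.
Qed.

Let P' : probability (T * measurableTypeR R)%type R :=
  (P \x uniform_prob (@ltr01 R))%E.

(** For almost every [w] in [E] the section at [w] is an interval of length [k c w], and [k c]
    integrates to [M E (cylinder c)] over [E]. *)
Lemma code_law E c : measurable E ->
  P' ([set x | E x.1] `&` [set x | code (size c) x = c]) =
  (M E (cylinder c))%:E.
Proof.
move=> mE; rewrite -k_int// [RHS]integral_mkcond.
rewrite /P'/= /product_measure1.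
have mS : measurable ([set x : T * R | E x.1] `&` [set x | code (size c) x = c]).
  apply: measurableI; last exact: code_meas.
  by rewrite -[X in measurable X]setTI; exact: measurable_fst.
apply: ge0_ae_eq_integral => //.
- exact: measurable_fun_xsection.
- apply/(measurable_restrictT _ mE); exact: measurable_funTS (kE_meas c).
- by move=> w _ /=; rewrite patchE; case: ifP => // _; rewrite lee_fin.
have : {ae P, forall w, good w}.
  by apply: filterS2 k_nil k_split => w k1 ks; split.
apply: filterS => w gw _ /=; rewrite patchE; case: ifPn => [/set_mem Ew|].
  rewrite -code_unif//; congr (U _); apply/seteqP; split => u;
    rewrite /xsection/=; first by move=> /set_mem[].
  by move=> ?; apply/mem_set.
move=> /negP wE; rewrite (_ : xsection _ _ = set0) ?measure0//.
apply/seteqP; split => u //; rewrite /xsection/= => /set_mem[/= Ew _].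
by apply: wE; apply/mem_set.
Qed.

End Realization.

Section Realize.
Context d (T : measurableType d) (R : realType) (P : probability T R).

(** The event is a finite disjoint union of cylinders of length [n], and [code_law] handles each of
    them. *)
Lemma realize_joint_content (M : joint_content P) :
  exists Z : nat -> T * measurableTypeR R -> bool,
  forall n (D : pred (seq bool)) (E : set T), measurable E ->
    measurable [set x | D (prefix_of n (Z^~ x))] /\
    (P \x uniform_prob (@ltr01 R))%E [set x | E x.1 /\ D (prefix_of n (Z^~ x))] =
    (M E [set z | D (prefix_of n z)])%:E.
Proof.
exists (decode M) => n D E mE.
have mE1 : measurable [set x : T * measurableTypeR R | E x.1].
  by rewrite -[X in measurable X]setTI; exact: measurable_fst.
have law (s : seq (seq bool)) : uniq s -> (forall c, c \in s -> size c = n) ->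
    measurable [set x | prefix_of n ((decode M)^~ x) \in s] /\
    (P \x uniform_prob (@ltr01 R))%E [set x | E x.1 /\ prefix_of n ((decode M)^~ x) \in s] =
    (M E [set z | prefix_of n z \in s])%:E.
  elim: s => [_ _|c s IH /= /andP[cs us] sz].
    rewrite (_ : [set x | _] = set0); last by apply/seteqP; split.
    rewrite (_ : [set x | _ /\ _] = set0); last by apply/seteqP; split => x // -[].
    rewrite (_ : [set z | _] = set0); last by apply/seteqP; split.
    by split => //; rewrite measure0 jc_set0r.
  have [|ms es] := IH us; first by move=> c' c's; apply: sz; rewrite inE c's orbT.
  have szc : size c = n by apply: sz; rewrite inE eqxx.
  have dec : [set x | prefix_of n ((decode M)^~ x) \in c :: s] =
      [set x | code M n x = c] `|` [set x | prefix_of n ((decode M)^~ x) \in s].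
    apply/seteqP; split => x /=; rewrite inE code_prefix.
      by move=> /orP[/eqP|]; [left|right].
    by move=> [->|->]; rewrite ?eqxx ?orbT.
  have mc := code_meas M n c.
  split; first by rewrite dec; exact: measurableU.
  rewrite (_ : [set x | _ /\ _] = [set x | E x.1] `&` [set x | code M n x = c] `|`
     [set x | E x.1 /\ prefix_of n ((decode M)^~ x) \in s]); last first.
    have -> : [set x : T * R | E x.1 /\ prefix_of n ((decode M)^~ x) \in c :: s] =
        [set x | E x.1] `&` [set x | prefix_of n ((decode M)^~ x) \in c :: s] by [].
    by rewrite dec setIUr.
  rewrite measureU//; last 3 first.
  - exact: measurableI.
  - exact: (measurableI _ _ mE1 ms).
  - apply/seteqP; split => x //= [[_ cx] [_]]; rewrite -code_prefix cx.
    by rewrite (negbTE cs).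
  have ec := code_law M c mE; rewrite szc in ec.
  apply: (etrans (congr2 (fun a b : \bar R => (a + b)%E) ec es)); rewrite /= /cylinder szc -EFinD -jc_addr//.
    congr (M E _)%:E; apply/seteqP; split => z /=; rewrite inE.
      by move=> [->|->]; rewrite ?eqxx ?orbT.
    by move=> /orP[/eqP|]; [left|right].
  by apply/seteqP; split => z // [/= ->]; rewrite (negbTE cs).
pose s := [seq tval t | t : n.-tuple bool <- enum {: n.-tuple bool} & D t].
have sE (z : nat -> bool) : (prefix_of n z \in s) = D (prefix_of n z).
  have szp : size (prefix_of n z) == n by rewrite size_prefix_of.
  rewrite -[prefix_of n z]/(tval (Tuple szp)) mem_map; last exact: val_inj.
  by rewrite mem_filter mem_enum andbT.
have [||m e] := law s.
- by rewrite (map_inj_uniq (@val_inj _ _ (n.-tuple bool))) filter_uniq ?enum_uniq.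
- by move=> c /mapP[t _ ->]; rewrite size_tuple.
split.
  by move: m; congr measurable; apply/seteqP; split => x /=; rewrite sE.
rewrite -(_ : [set z | prefix_of n z \in s] = [set z | D (prefix_of n z)]); last first.
  by apply/seteqP; split => x /=; rewrite sE.
by rewrite -e; congr (product_measure1 _ _ _); apply/seteqP; split => x /=; rewrite sE.
Qed.

End Realize.

(** * Ultralimits of joint laws *)

(** Compactness gives a cluster point. If the preimage of one of its neighbourhoods were not in [F],
    the complement would be, against clustering. *)
Lemma ultra_cvg_segment (R : realType) (F : set_system nat) (u : nat -> R) a b :
  UltraFilter F -> (forall n, a <= u n <= b) -> exists l : R, u n @[n --> F] --> l.
Proof.
move=> FU uab; have uF : (u @ F) `[a, b]%classic.
  have -> : (u @ F) `[a, b]%classic = F (u @^-1` `[a, b]%classic) by [].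
  rewrite (_ : _ @^-1` _ = setT); first exact: filterT.
  by apply/seteqP; split => n _ //; rewrite /= in_itv/= uab.
have [l [_ cl]] := @segment_compact R a b (u @ F) _ uF.
exists l => A Al; have [//|FnA] := in_ultra_setVsetC (u @^-1` A) FU.
have [y [ny Ay]] := cl (~` A) A FnA Al.
by [].
Qed.

Section Limit.
Context d (T : measurableType d) (R : realType) (P : probability T R).
Variables (M : nat -> joint_content P) (F : set_system nat).
Hypotheses (FU : UltraFilter F) (Foo : \oo `<=` F).

Let lim_ex E Q : measurable E -> exists l : R, M n E Q @[n --> F] --> l.
Proof.
move=> mE; apply: (@ultra_cvg_segment R F (fun n => M n E Q) 0 1) => n.
rewrite jc_ge0 (le_trans (jc_le_prob _ _ mE))//.
by rewrite -lee_fin fineK ?fin_num_measure// probability_le1.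
Qed.

(** Limits are available for measurable [E] only; elsewhere the value 0 respects nonnegativity, the
    one axiom that reaches such sets. *)
Let lim_jc E Q : R :=
  if pselect (measurable E) is left mE then sval (cid (lim_ex Q mE)) else 0.

Let lim_jcP E Q : measurable E -> M n E Q @[n --> F] --> lim_jc E Q.
Proof. by rewrite /lim_jc; case: pselect => // mE _; case: cid. Qed.

Let lim_jc_uniq E Q (l : R) : measurable E ->
  M n E Q @[n --> F] --> l -> lim_jc E Q = l.
Proof. by move=> mE; apply: cvg_unique (@lim_jcP E Q mE). Qed.

Let lim_ge0 E Q : 0 <= lim_jc E Q.
Proof.
have [mE|nE] := pselect (measurable E); last by rewrite /lim_jc; case: pselect.
apply: (cvgr_to_ge (lim_jcP mE)).
by apply: (filterS _ (@filterT _ F _)) => n _; exact: jc_ge0.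
Qed.

Let lim_setT E : measurable E -> lim_jc E setT = fine (P E).
Proof.
move=> mE; apply: lim_jc_uniq => //.
under eq_fun do rewrite jc_setT//.
exact: cvg_cst.
Qed.

Let lim_addl E E' Q : measurable E -> measurable E' ->
  E `&` E' = set0 -> lim_jc (E `|` E') Q = lim_jc E Q + lim_jc E' Q.
Proof.
move=> mE mE' EE'; apply: lim_jc_uniq; first exact: measurableU.
under eq_fun do rewrite jc_addl//.
by apply: cvgD; exact: lim_jcP.
Qed.

Let lim_addr E Q Q' : measurable E ->
  Q `&` Q' = set0 -> lim_jc E (Q `|` Q') = lim_jc E Q + lim_jc E Q'.
Proof.
move=> mE QQ'; apply: lim_jc_uniq => //.
under eq_fun do rewrite jc_addr//.
by apply: cvgD; exact: lim_jcP.
Qed.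

Definition jc_limit : joint_content P :=
  JointContent lim_ge0 lim_setT lim_addl lim_addr.

Lemma jc_limitE E Q r : measurable E -> (\forall n \near \oo, M n E Q = r) ->
  jc_limit E Q = r.
Proof.
move=> mE /Foo Mr; apply: lim_jc_uniq => //.
by apply: (cvg_trans (near_eq_cvg _) (cvg_cst r)); apply: filterS Mr => n ->.
Qed.

End Limit.

(** Any identity that holds exactly from some [n] on survives in the limit; each finite constraint
    on the bits is of this kind. *)
Lemma jc_limit_exists d (T : measurableType d) (R : realType)
    (P : probability T R) (M : nat -> joint_content P) :
  exists L : joint_content P, forall E Q r, measurable E ->
    (\forall n \near \oo, M n E Q = r) -> L E Q = r.
Proof.
have [F [FU Foo]] := @ultraFilterLemma nat \oo _.
by exists (jc_limit M FU) => E Q r; exact: jc_limitE.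
Qed.

(** * Couplings for finitely many points *)

Section FiniteValued.
Context d (T : measurableType d) (R : realType) (P : probability T R).

Lemma measurable_countable_preimage (I : countType) (f : T -> I) (D : set I) :
  (forall i, measurable [set w | f w = i]) -> measurable [set w | D (f w)].
Proof.
move=> mf; rewrite (_ : [set w | _] = \bigcup_k
    (if @pickle_inv I k is Some i then
       (if pselect (D i) then [set w | f w = i] else set0) else set0)).
  apply: bigcupT_measurable => k; case: pickle_inv => // i.
  by case: pselect => ? /=; [exact: mf|exact: measurable0].
apply/seteqP; split => w /=.
  by move=> Dw; exists (choice.pickle (f w)) => //; rewrite pickleK_inv; case: pselect.
by move=> [k _]; case: pickle_inv => // i; case: pselect => // Di /= ->.
Qed.

Lemma measurable_bool_eq (X : T -> bool) v :
  bool_rv X -> measurable [set w | X w = v].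
Proof.
move=> mX; case: v; first exact: mX.
rewrite (_ : [set w | _] = ~` [set w | X w]); first exact: measurableC.
by apply/seteqP; split => w /=; case: (X w) => // h; exfalso; apply: h.
Qed.

Lemma prob_finite_valued (I : finType) (f : T -> I) (D : pred I) E :
  measurable E -> (forall i, measurable [set w | f w = i]) ->
  fine (P (E `&` [set w | D (f w)])) =
  \sum_(i | D i) fine (P (E `&` [set w | f w = i])).
Proof.
move=> mE mf.
suff law (s : seq I) : uniq s -> fine (P (E `&` [set w | f w \in s])) =
    \sum_(i <- s) fine (P (E `&` [set w | f w = i])).
  rewrite -big_filter -law ?filter_uniq ?index_enum_uniq//.
  by congr (fine (P (_ `&` _))); apply/seteqP; split => w /=;
    rewrite mem_filter mem_index_enum andbT.
elim: s => [_|i s IH /= /andP[si us]].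
  by rewrite big_nil (_ : [set w | _] = set0) ?setI0 ?measure0//; apply/seteqP; split.
rewrite big_cons -IH// -fineD ?fin_num_measure//; last 2 first.
- exact: measurableI.
- by apply: measurableI => //; exact: (measurable_countable_preimage [set i | i \in s]).
rewrite -measureU//.
- congr (fine (P _)); rewrite -setIUr; congr (_ `&` _).
  apply/seteqP; split => w /=; rewrite inE.
    by move=> /orP[/eqP|]; [left|right].
  by move=> [->|->]; rewrite ?eqxx ?orbT.
- exact: measurableI.
- by apply: measurableI => //; exact: (measurable_countable_preimage [set i | i \in s]).
- apply/seteqP; split => w // -[[_ /= ->] [_ /=]].
  by rewrite (negbTE si).
Qed.

End FiniteValued.

Section Approximation.
Context (R : realType) (A B : countType) (p : R).
Hypotheses (p_ge0 : 0 <= p) (p_le1 : p <= 1).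
Context d (T : measurableType d) (P : probability T R).
Variables (X Xd : B -> T -> bool) (S Sd : T -> B -> A).
Hypotheses (hX : forall b, bernoulli_rv P p (X b))
  (hXd : forall b, bernoulli_rv P p (Xd b))
  (hindep : indep_bool_family P (join_family X Xd))
  (mS : forall b a, measurable [set w | S w b = a])
  (mSd : forall b a, measurable [set w | Sd w b = a]).
Variables (n : nat) (bs : n.-tuple B) (V : {fset A}).
Hypothesis bs_uniq : uniq bs.

Let bits w : n.-tuple (bool * bool) := [tuple of map (fun b => (X b w, Xd b w)) bs].

Lemma prob_bernoulli (Y : T -> bool) v : bernoulli_rv P p Y ->
  P [set w | Y w = v] = (bern p v)%:E.
Proof.
move=> [mY PY]; case: v; first exact: PY.
rewrite (_ : [set w | _] = ~` [set w | Y w]); last first.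
  by apply/seteqP; split => w /=; case: (Y w) => // h; exfalso; apply: h.
by rewrite probability_setC// PY.
Qed.

Let bits_law xs :
  P [set w | bits w = xs] = (\prod_(x <- xs) (bern p x.1 * bern p x.2))%:E.
Proof.
pose x0 := (true, true).
(* The event on [bits] is rewritten as prescribed values for the family [join_family X Xd]; distinct
   entries of [bs] make this unambiguous. *)
pose v (i : B + B) := match i with
  | inl b => (nth x0 xs (index b bs)).1 | inr b => (nth x0 xs (index b bs)).2 end.
pose s := map inl bs ++ map inr bs : seq (B + B).
have nth_index_tnth i : nth x0 xs (index (tnth bs i) bs) = tnth xs i.
  by rewrite (tnth_nth (tnth bs i) bs) index_uniq ?size_tuple// -tnth_nth.
have inF i : i \in [fset x in s]%fset = (i \in s) by rewrite !inE mem_cat.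
have us : uniq s.
  rewrite cat_uniq !map_inj_uniq ?bs_uniq/= ?andbT; try by move=> ? ? [].
  by apply/hasPn => _ /mapP[b _ ->]; apply/mapP => -[].
have := hindep [fset x in s]%fset v.
rewrite (perm_big s)/=; last first.
  by apply: uniq_perm; rewrite ?fset_uniq.
under eq_bigr => i _.
  rewrite (prob_bernoulli (Y := join_family X Xd i)); last by case: i => b /=.
  over.
rewrite prodEFin /s big_cat !big_map/= -big_split/= => hP.
transitivity (\prod_(b <- bs) (bern p (v (inl b)) * bern p (v (inr b))))%:E.
  rewrite -hP; congr (P _); apply/seteqP; split => w /=.
    move=> wxs [b|b] /=; rewrite inF mem_cat => /orP[] /mapP[b' bb' // [->]];
      by rewrite /v -wxs (nth_map b') ?index_mem// nth_index.
  move=> h; apply: eq_from_tnth => i.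
  have bi := mem_tnth i bs.
  have hl : X (tnth bs i) w = v (inl (tnth bs i)).
    by apply: (h (inl _)); rewrite /= inF mem_cat map_f.
  have hr : Xd (tnth bs i) w = v (inr (tnth bs i)).
    by apply: (h (inr _)); rewrite /= inF mem_cat orbC map_f.
  by rewrite tnth_map hl hr /v nth_index_tnth -surjective_pairing.
rewrite !big_tuple; congr EFin; apply: eq_bigr => i _.
by rewrite /v nth_index_tnth.
Qed.

(** Section values outside of [V] are collapsed to [None], so that states range over a finite
    type. *)
Let state b w := ((X b w, Xd b w),
  (insub (S w b) : option V, insub (Sd w b) : option V)).

Let states w := [tuple of map (state^~ w) bs].

Let states_meas x : measurable [set w | states w = x].
Proof.
have insub_meas (f : T -> A) (o : option V) :
    (forall a, measurable [set w | f w = a]) -> measurable [set w | insub (f w) = o].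
  by move=> mf; exact: (measurable_countable_preimage [set a | insub a = o]).
have mst b q : measurable [set w | state b w = q].
  case: q => -[x1 x2] [t1 t2].
  rewrite (_ : [set w | _] = ([set w | X b w = x1] `&` [set w | Xd b w = x2]) `&`
    ([set w | insub (S w b) = t1] `&` [set w | insub (Sd w b) = t2])); last first.
    apply/seteqP; split => w /=; first by move=> [] <- <- <- <-.
    by rewrite /state => -[[-> ->] [-> ->]].
  apply: measurableI; apply: measurableI.
  - by apply: measurable_bool_eq; have [] := hX b.
  - by apply: measurable_bool_eq; have [] := hXd b.
  - exact: insub_meas.
  - exact: insub_meas.
rewrite (_ : [set w | _] = \bigcap_(i in [set: 'I_n])
    [set w | state (tnth bs i) w = tnth x i]); last first.
  apply/seteqP; split => w /=; first by move=> <- i _; rewrite tnth_map.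
  by move=> h; apply: eq_from_tnth => i; rewrite tnth_map; exact: h.
by apply: fin_bigcap_measurable => //; exact: finite_finset.
Qed.

(** Every [b] gets its own copy of the bits over all of [V], so the blocks of distinct [b] are
    independent under [g]. *)
Let window := {ffun V -> bool}.

Let f x : R := fine (P [set w | states w = x]).
Let g (zs : n.-tuple window) : R := \prod_(z <- zs) \prod_a bern p (z a).

Let consistent (x : n.-tuple _) (zs : n.-tuple window) :=
  [forall i, compat (tnth x i).1 (tnth x i).2 (tnth zs i)].

Let fE (D : pred _) : fine (P [set w | D (states w)]) = \sum_(x | D x) f x.
Proof.
rewrite -[X in P X]setTI prob_finite_valued//.
by apply: eq_bigr => x _; rewrite setTI.
Qed.

(** The mass of [C] is at most the probability that the bits are those of some state in [C]. Such a
    state provides the adversary's moves, so [game_tensor] applies. *)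
Let hall : hall_condition consistent f g.
Proof.
move=> C; rewrite -fE.
pose W (xs : n.-tuple (bool * bool)) :=
  [exists x in C, [tuple of map fst x] == xs].
apply: (@le_trans _ _ (\sum_(xs | W xs) \prod_(x <- xs) (bern p x.1 * bern p x.2))).
  have mbits xs : measurable [set w | bits w = xs].
    rewrite (_ : [set w | _] = [set w | map_tuple fst (states w) = xs]).
      exact: (@measurable_countable_preimage _ _ _ states
        [set x | map_tuple fst x = xs]).
    suff e w : bits w = map_tuple fst (states w).
      by apply/seteqP; split => w /=; rewrite e.
    by apply: eq_from_tnth => i; rewrite !tnth_map.
  have -> : \sum_(xs | W xs) \prod_(x <- xs) (bern p x.1 * bern p x.2) =
      fine (P [set w | W (bits w)]).
    rewrite -[X in P X]setTI prob_finite_valued//.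
    by apply: eq_bigr => xs _; rewrite setTI bits_law.
  have mW : measurable [set w | W (bits w)].
    exact: (@measurable_countable_preimage _ _ _ bits [set xs | W xs]).
  have mC : measurable [set w | states w \in C].
    exact: (@measurable_countable_preimage _ _ _ states [set x | x \in C]).
  apply: fine_le; rewrite ?fin_num_measure//; apply: le_measure => //; try exact/mem_set.
  move=> w /= wC; apply/existsP; exists (states w); rewrite wC/=.
  by apply/eqP/eq_from_tnth => i; rewrite !tnth_map.
have fibre := @fibre_game R p V p_ge0 p_le1.
apply: (game_tensor _ _ fibre) => [x|z|xs /existsP[x /andP[xC /eqP <-]]].
- by rewrite mulr_ge0// bern_ge0.
- by apply: prodr_ge0 => a _; exact: bern_ge0.
exists [tuple of map snd x] => zs h; rewrite inE; apply/existsP; exists x.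
by rewrite xC; apply/forallP => i; have := h i; rewrite !tnth_map.
Qed.

Let field (zs : n.-tuple window) (b : B) (a : A) : bool :=
  if insub a is Some v then nth [ffun=> false] zs (index b bs) v else false.

Let field_val zs i (v : V) : field zs (tnth bs i) (val v) = tnth zs i v.
Proof.
rewrite /field valK (tnth_nth (tnth bs i) bs) index_uniq ?size_tuple//.
by rewrite (tnth_nth [ffun=> false]).
Qed.

Let g_field zs : g zs = \prod_(k : 'I_n * V) bern p (tnth zs k.1 k.2).
Proof. by rewrite /g big_tuple pair_big. Qed.

Let g_marginal (G : seq (B * A)) (u : B * A -> bool) : uniq G ->
  {in G, forall x, x.1 \in bs /\ x.2 \in V} ->
  \sum_(zs | all (fun x => field zs x.1 x.2 == u x) G) g zs =
  \prod_(x <- G) bern p (u x).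
Proof.
move=> uG GV.
pose e (k : 'I_n * V) : B * A := (tnth bs k.1, val k.2).
have e_inj : injective e.
  move=> [i v] [j v'] [/eqP]; rewrite (tnth_nth (tnth bs i)) [X in _ == X](tnth_nth (tnth bs i)).
  by rewrite nth_uniq ?size_tuple// => /eqP/val_inj -> /val_inj ->.
have Ge x : x \in G -> exists k, x = e k.
  move=> /GV[/tnthP[i xi] xV]; exists (i, [` xV]%fset).
  by case: (x) xi xV => b a /= -> ?.
pose D k := e k \in G.
have -> : \prod_(x <- G) bern p (u x) = \prod_(k | D k) bern p (u (e k)).
  transitivity (\prod_(x <- [seq e k | k <- index_enum _ & D k]) bern p (u x));
    last by rewrite big_map big_filter.
  apply: perm_big; apply: uniq_perm => //.
    by rewrite map_inj_uniq// filter_uniq// index_enum_uniq.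
  move=> x; apply/idP/mapP => [xG|[k]]; last first.
    by rewrite mem_filter => /andP[Dk _] ->.
  have [k xe] := Ge _ xG; exists k => //.
  by rewrite mem_filter mem_index_enum /D -xe xG.
rewrite -bern_marginal.
(* Uncurrying turns [g] into a single Bernoulli product, to which [bern_marginal] applies. *)
pose h (z : {ffun 'I_n * V -> bool}) : n.-tuple window :=
  [tuple [ffun a => z (i, a)] | i < n].
rewrite (reindex h); last first.
  exists (fun zs : n.-tuple window => [ffun k => tnth zs k.1 k.2]) => [z _|zs _].
    by apply/ffunP => -[i a]; rewrite !ffunE /= tnth_mktuple ffunE.
  by apply: eq_from_tnth => i; apply/ffunP => a; rewrite tnth_mktuple !ffunE.
have hE z i a : tnth (h z) i a = z (i, a) by rewrite tnth_mktuple ffunE.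
apply: eq_big => [z|z _]; last first.
  by rewrite g_field; apply: eq_bigr => -[i a] _; rewrite hE.
apply/allP/forallP => [zG [i v]|zD x xG].
  by apply/implyP => /zG /=; rewrite field_val hE.
have [[i v] xe] := Ge _ xG; have /implyP := zD (i, v).
by rewrite /D -xe => /(_ xG); rewrite xe /= field_val hE.
Qed.

Let sum_g : \sum_zs g zs = 1.
Proof.
have := @g_marginal [::] xpredT isT; by rewrite big_nil => <-.
Qed.

Let sum_f : \sum_x f x = 1.
Proof. by rewrite -fE (_ : [set w | _] = setT) ?probability_setT//; apply/seteqP. Qed.

Let coupled : exists K, coupling consistent f g K.
Proof.
apply: weighted_hall hall => [x|zs]; first exact: fine_ge0.
by apply: prodr_ge0 => z _; apply: prodr_ge0 => a _; exact: bern_ge0.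
Qed.

Let K := sval (cid coupled).

Let KP : coupling consistent f g K. Proof. exact: (svalP (cid coupled)). Qed.

Let K_ge0 x zs : 0 <= K x zs. Proof. by have [] := KP. Qed.

Let K_eq0 x zs : f x = 0 -> K x zs = 0.
Proof.
have [_ _ Kf _] := KP; rewrite -Kf => /psumr_eq0P; apply => //.
Qed.

Let part E x : R := fine (P (E `&` [set w | states w = x])).

Let part_ge0 E x : 0 <= part E x. Proof. exact: fine_ge0. Qed.

Let part_le E x : measurable E -> part E x <= f x.
Proof.
move=> mE; apply: fine_le; rewrite ?fin_num_measure//; first exact: measurableI.
by apply: le_measure => //; apply/mem_set => //; exact: measurableI.
Qed.

(** Given the state [x], the bits follow [K x zs / f x], independently of the point within that
    state. If [f x = 0], the quotient is 0, but [part E x] vanishes too for measurable [E]. *)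
Let weight E zs := \sum_x part E x * (K x zs / f x).

Let weight_ge0 E zs : 0 <= weight E zs.
Proof. by apply: sumr_ge0 => x _; rewrite mulr_ge0// divr_ge0// fine_ge0. Qed.

(** The bits over [B * A] become one sequence through the encoding of pairs; codes of no pair, and
    pairs outside of the finite window, read [false]. *)
Let point zs (k : nat) : bool :=
  if @pickle_inv (B * A)%type k is Some x then field zs x.1 x.2 else false.

Let point_pickle zs x : point zs (choice.pickle x) = field zs x.1 x.2.
Proof. by rewrite /point pickleK_inv. Qed.

Let approx E Q := \sum_(zs | `[< Q (point zs) >]) weight E zs.

Let approx_ge0 E Q : 0 <= approx E Q.
Proof. exact: sumr_ge0. Qed.

Let approx_setT E : measurable E -> approx E setT = fine (P E).
Proof.
move=> mE; rewrite /approx (eq_bigl xpredT) => [|zs]; last by apply/asboolP.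
rewrite exchange_big/= -[in RHS](setIT E).
rewrite (_ : [set: T] = [set w | xpredT (states w)]); last by apply/seteqP.
rewrite (prob_finite_valued P xpredT mE states_meas).
apply: eq_bigr => x _; rewrite -mulr_sumr -mulr_suml.
have [_ _ -> _] := KP; have [fx|fx] := eqVneq (f x) 0.
  by apply/eqP; rewrite fx mul0r mulr0 eq_sym eq_le -[X in _ <= X]fx part_le//= part_ge0.
by rewrite divff// mulr1.
Qed.

Let approx_addl E E' Q : measurable E -> measurable E' -> E `&` E' = set0 ->
  approx (E `|` E') Q = approx E Q + approx E' Q.
Proof.
move=> mE mE' EE'; rewrite /approx -big_split/=; apply: eq_bigr => zs _.
rewrite /weight -big_split/=; apply: eq_bigr => x _; rewrite -mulrDl.
congr (_ * _); rewrite /part setIUl measureU//.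
- by rewrite fineD// fin_num_measure//; exact: measurableI.
- exact: measurableI.
- exact: measurableI.
- by rewrite setIACA EE' set0I.
Qed.

Let approx_addr E Q Q' : measurable E -> Q `&` Q' = set0 ->
  approx E (Q `|` Q') = approx E Q + approx E Q'.
Proof.
move=> mE QQ'; rewrite /approx (bigID (fun zs => `[< Q (point zs) >]))/=.
congr (_ + _); apply: eq_bigl => zs; apply/andP/asboolP.
- by move=> [_ /asboolP].
- by move=> Qz; split; apply/asboolP => //; left.
- by move=> [/asboolP[Qz /asboolP//|//]].
- move=> Qz; split; first by apply/asboolP; right.
  apply/asboolP => Q'z.
  by have : (Q `&` Q') (point zs) by []; rewrite QQ'.
Qed.

Definition approx_jc : joint_content P :=
  JointContent approx_ge0 approx_setT approx_addl approx_addr.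

(** For [E = setT] the weight of [zs] is the second marginal of [K], which is [g zs] because [f] and
    [g] both have mass 1. *)
Lemma approx_jc_iid (G : seq (B * A)) (u : B * A -> bool) : uniq G ->
  {in G, forall x, x.1 \in bs /\ x.2 \in V} ->
  approx_jc setT [set z | all (fun x => z (choice.pickle x) == u x) G] =
  \prod_(x <- G) bern p (u x).
Proof.
move=> uG GV; rewrite -g_marginal//=; apply: eq_big => [zs|zs _].
  rewrite -(@eq_all _ (fun x => point zs (choice.pickle x) == u x)).
    exact/asboolP/idP.
  by move=> x; rewrite /= point_pickle.
rewrite /weight -(coupling_marginal KP) ?sum_f ?sum_g//.
apply: eq_bigr => x _; rewrite /part setTI -/(f x).
have [fx|fx] := eqVneq (f x) 0; first by rewrite fx mul0r K_eq0.
by rewrite mulrC divfK.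
Qed.

(** Every term vanishes: a state that meets the event is inconsistent with [zs], so [K] is 0 there,
    and the other states have an empty part. *)
Lemma approx_jc_allowed b s sd x xd : b \in bs -> s \in V -> sd \in V -> s != sd ->
  approx_jc [set w | [/\ X b w = x, Xd b w = xd, S w b = s & Sd w b = sd]]
    [set z | ~~ allowed x xd (z (choice.pickle (b, s))) (z (choice.pickle (b, sd)))] = 0.
Proof.
move=> /tnthP[i ->] sV sdV ssd; apply: big1 => zs /asboolP /=.
rewrite !point_pickle /= -[s]/(val [` sV]%fset) -[sd]/(val [` sdV]%fset).
rewrite !field_val => nall; apply: big1 => y _.
set E := [set w | _]; have [[w [[wx wxd ws wsd] wy]]|E0] :=
  pselect ((E `&` [set w | states w = y]) !=set0).
  have [_ K0 _ _] := KP; rewrite K0 ?mul0r ?mulr0//.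
  apply/forallPn; exists i; rewrite -wy tnth_map /= /compat /= wx wxd ws wsd.
  by rewrite -[s]/(val [` sV]%fset) -[sd]/(val [` sdV]%fset) !valK/= negb_imply nall ssd.
rewrite /part (_ : _ `&` _ = set0) ?measure0 ?mul0r//.
by apply/eqP; rewrite -[_ == _]negbK; apply/negP => /set0P.
Qed.

End Approximation.

(** * The coupling *)

(** Restates the realization for events depending on the first [n] bits, without mention of
    words. *)
Lemma realize_finitary d (T : measurableType d) (R : realType)
    (P : probability T R) (M : joint_content P) :
  exists Z : nat -> T * measurableTypeR R -> bool,
  forall n (Q : set (nat -> bool)) (E : set T),
    (forall z z', (forall i, (i < n)%N -> z i = z' i) -> Q z -> Q z') ->
    measurable E -> measurable [set x | Q (Z^~ x)] /\
    (P \x uniform_prob (@ltr01 R))%E [set x | E x.1 /\ Q (Z^~ x)] = (M E Q)%:E.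
Proof.
have [Z HZ] := realize_joint_content M; exists Z => n Q E Qn mE.
pose D c := `[< exists2 z, prefix_of n z = c & Q z >].
have DE z : D (prefix_of n z) <-> Q z.
  split=> [/asboolP[z' /eq_prefix_of zz' Qz']|Qz]; first exact: Qn Qz'.
  by apply/asboolP; exists z.
have [mD PD] := HZ n D E mE.
have -> : Q = [set z | D (prefix_of n z)] by apply/seteqP; split => z /DE.
by split.
Qed.

Section Content.
Context (R : realType) (A B : countType) (p : R).
Hypotheses (p_ge0 : 0 <= p) (p_le1 : p <= 1).
Context d (T : measurableType d) (P : probability T R).
Variables (X Xd : B -> T -> bool) (S Sd : T -> B -> A).
Hypotheses (hX : forall b, bernoulli_rv P p (X b))
  (hXd : forall b, bernoulli_rv P p (Xd b))
  (hindep : indep_bool_family P (join_family X Xd))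
  (mS : forall b a, measurable [set w | S w b = a])
  (mSd : forall b a, measurable [set w | Sd w b = a]).

(** The [n]-th approximation uses the points of [A] and [B] with code below [n]; each requirement
    involves finitely many points, so it is exact for large [n]. *)
Lemma coupling_content : exists M : joint_content P,
  (forall (G : seq (B * A)) (u : B * A -> bool), uniq G ->
    M setT [set z | all (fun x => z (choice.pickle x) == u x) G] =
    \prod_(x <- G) bern p (u x)) /\
  (forall b s sd x xd, s != sd ->
    M [set w | [/\ X b w = x, Xd b w = xd, S w b = s & Sd w b = sd]]
      [set z | ~~ allowed x xd (z (choice.pickle (b, s))) (z (choice.pickle (b, sd)))]
    = 0).
Proof.
pose first (I : countType) n : seq I := pmap pickle_inv (iota 0 n).
have mem_first (I : countType) n (i : I) : (i \in first I n) = (choice.pickle i < n)%N.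
  rewrite mem_pmap; apply/mapP/idP => [[k]|ni].
    rewrite mem_iota => /andP[_ kn] iE.
    by have := @pickle_invK I k; rewrite -iE /= => ->.
  by exists (choice.pickle i); rewrite ?mem_iota// pickleK_inv.
have first_uniq (I : countType) n : uniq (first I n).
  by apply: (pmap_uniq (@pickle_invK I)); exact: iota_uniq.
have [M HM] := jc_limit_exists (fun n =>
  approx_jc p_ge0 p_le1 hX hXd hindep mS mSd [fset a in first A n]%fset
    (bs := in_tuple (first B n)) (first_uniq B n)).
exists M; split.
- move=> G u uG; apply: HM => //.
  pose N := \max_(x <- G) maxn (choice.pickle x.1) (choice.pickle x.2).
  exists N.+1 => // n Nn; apply: approx_jc_iid => // x xG.
  rewrite !inE /= !mem_first.
  have : (maxn (choice.pickle x.1) (choice.pickle x.2) < n)%N.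
    by apply: leq_trans Nn; rewrite ltnS; exact: (leq_bigmax_seq x).
  by rewrite gtn_max => /andP.
- move=> b s sd x xd ssd; apply: HM => //.
    rewrite (_ : [set w | _] = ([set w | X b w = x] `&` [set w | Xd b w = xd]) `&`
      ([set w | S w b = s] `&` [set w | Sd w b = sd])); last first.
      by apply/seteqP; split => w /=; [move=> []|move=> [[? ?] [? ?]]].
    apply: measurableI; apply: measurableI => //.
    + by apply: measurable_bool_eq; have [] := hX b.
    + by apply: measurable_bool_eq; have [] := hXd b.
  exists (maxn (choice.pickle b) (maxn (choice.pickle s) (choice.pickle sd))).+1 => // n Nn.
  have /and3P[bn sn sdn] : [&& choice.pickle b < n, choice.pickle s < n &
      choice.pickle sd < n]%N by rewrite -!gtn_max; exact: Nn.
  by apply: approx_jc_allowed; rewrite // ?inE /= ?mem_first.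
Qed.

End Content.

Theorem theorem3p1 (R : realType) (A B : countType) (pi : A -> B)
  (hA : exists a : A, True) (hB : exists b : B, True)
  (pi_surj : forall b : B, exists a : A, pi a = b)
  (p : R) (hp0 : 0 <= p) (hp1 : p <= 1)
  (d : measure_display) (T : measurableType d) (P : probability T R)
  (X Xd : B -> T -> bool)
  (hX : forall b, bernoulli_rv P p (X b))
  (hXd : forall b, bernoulli_rv P p (Xd b))
  (hindep : indep_bool_family P (join_family X Xd))
  (S Sd : T -> B -> A)
  (hS : random_section pi S) (hSd : random_section pi Sd)
  (hdist : forall b, {ae P, forall w, S w b <> Sd w b}) :
  exists (d' : measure_display) (T' : measurableType d')
         (P' : probability T' R) (phi : T' -> T),
    extension P P' phi /\
    exists Y Z : A -> T' -> bool,
      (forall a, bool_rv (Y a)) /\ (forall a, bool_rv (Z a)) /\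
      {ae P', forall w',
        let w := phi w' in
        (* (1a) *)
        (forall a, a <> S w (pi a) -> a <> Sd w (pi a) -> Y a w' = false) /\
        (* (1b) *)
        (forall b, X b w = false -> Xd b w = false ->
            Y (S w b) w' = false /\ Y (Sd w b) w' = false) /\
        (* (1c) *)
        (forall b, X b w = true -> Xd b w = false ->
            Y (S w b) w' = true /\ Y (Sd w b) w' = false) /\
        (* (1d) *)
        (forall b, X b w = true -> Xd b w = true ->
            Y (S w b) w' = true /\ Y (Sd w b) w' = true) /\
        (* (1e) *)
        (forall b, X b w = false -> Xd b w = true ->
            exists a, (a = S w b \/ a = Sd w b) /\ Y a w' = true /\
              forall a', (a' = S w b \/ a' = Sd w b) -> Y a' w' = true ->
                a' = a) /\
        (* (3) *)
        (forall a, (Y a w' <= Z a w')%N)} /\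
      (* (2) *)
      iid_bernoulli_family P' p Z.
Proof.
have [[mS piS] [mSd piSd]] := (hS, hSd).
have [M [Miid Mall]] := coupling_content hp0 hp1 hX hXd hindep mS mSd.
have [z hz] := realize_finitary M.
pose P' : probability (T * measurableTypeR R)%type R :=
  (P \x uniform_prob (@ltr01 R))%E.
(* Of the bits over [B * A], only those on the graph of [pi] are kept. [Y] is forced by (1) except
   when [X] is 0 and [Xd] is 1: then the single 1 goes to [S] if [Z] is 1 there, and otherwise to
   [Sd], where [allowed] makes [Z] equal to 1. *)
pose Z a x := z (choice.pickle (pi a, a)) x.
pose Y a x := let w := x.1 in let b := pi a in
  if a == S w b then X b w || Xd b w && Z a x
  else (a == Sd w b) && (Xd b w && (X b w || ~~ Z (S w b) x)).
have ext : extension P P' fst.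
  split=> [|E mE]; first exact: measurable_fst.
  rewrite (_ : fst @^-1` E = E `*` setT); last first.
    by apply/seteqP; split => x //= -[].
  rewrite /P'/= product_measure1E//.
  by rewrite [X in (_ * X)%E](_ : _ = 1%E) ?mule1//; exact: probability_setT.
have mfst (E : set T) : measurable E -> measurable [set x : T * measurableTypeR R | E x.1].
  by move=> mE; have [/(_ measurableT _ mE)] := ext; rewrite setTI.
have mz k : measurable [set x | z k x].
  by have [] := hz k.+1 [set c | c k] setT (fun c c' h => etrans (esym (h k (ltnSn k)))) measurableT.
have mZ a : bool_rv (Z a) by exact: mz.
have mE b s sd x xd : measurable
    [set w | [/\ X b w = x, Xd b w = xd, S w b = s & Sd w b = sd]].
  rewrite (_ : [set w | _] = ([set w | X b w = x] `&` [set w | Xd b w = xd]) `&`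
    ([set w | S w b = s] `&` [set w | Sd w b = sd])); last first.
    by apply/seteqP; split => w /=; [move=> []|move=> [[? ?] [? ?]]].
  apply: measurableI; apply: measurableI => //.
  - by apply: measurable_bool_eq; have [] := hX b.
  - by apply: measurable_bool_eq; have [] := hXd b.
(* For fixed [b], [s], [sd] and fixed values of the two bits, the bad event is null by [Mall]; there
   are countably many such choices. *)
have ae_allowed : {ae P', forall x (q : B * A * A), q.1.2 != q.2 ->
    S x.1 q.1.1 = q.1.2 -> Sd x.1 q.1.1 = q.2 ->
    allowed (X q.1.1 x.1) (Xd q.1.1 x.1)
      (z (choice.pickle (q.1.1, q.1.2)) x) (z (choice.pickle (q.1.1, q.2)) x)}.
  apply: ae_forall_count => -[[b s] sd] /=.
  have [->|ssd] := eqVneq s sd; first exact: aeW.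
  have : {ae P', forall x (v : bool * bool),
      X b x.1 = v.1 -> Xd b x.1 = v.2 -> S x.1 b = s -> Sd x.1 b = sd ->
      allowed v.1 v.2 (z (choice.pickle (b, s)) x) (z (choice.pickle (b, sd)) x)}.
    apply: ae_forall_count => -[v vd] /=.
    pose Q := [set c : nat -> bool | ~~ allowed v vd
      (c (choice.pickle (b, s))) (c (choice.pickle (b, sd)))].
    have [|mQ] := hz (maxn (choice.pickle (b, s)) (choice.pickle (b, sd))).+1 Q _ _ (mE b s sd v vd).
      move=> c c' cc'; rewrite /Q/= !cc'//.
        by rewrite ltnS leq_maxr.
      by rewrite ltnS leq_maxl.
    rewrite Mall// => PQ; exists ([set x | [/\ X b x.1 = v, Xd b x.1 = vd,
      S x.1 b = s & Sd x.1 b = sd]] `&` [set x | Q (z^~ x)]); split.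
    - exact: (measurableI _ _ (mfst _ (mE b s sd v vd)) mQ).
    - exact: PQ.
    - move=> x /= /not_implyP[Xv /not_implyP[Xdv /not_implyP[Ss /not_implyP[Sds /negP h]]]].
      by split.
  by apply: filterS => x h _ Ss Sds; exact: (h (X b x.1, Xd b x.1)).
have ae_dist : {ae P', forall x b, S x.1 b <> Sd x.1 b}.
  apply: ae_forall_count => b; have [N [mN PN sN]] := hdist b.
  exists [set x | N x.1]; split; first exact: mfst.
    by have [_ /(_ _ mN)] := ext; rewrite PN.
  by move=> x /= h; apply: sN.
exists _, _, P', fst; split=> //; exists Y, Z; split; [|split=> //; split].
- move=> a; set b := pi a.
  (* [Y a] is a function of this countably valued map. The random index in [Z (S x.1 b)] is harmless
     once the value of [S] is fixed. *)
  pose f x := (S x.1 b, Sd x.1 b, (X b x.1, Xd b x.1), (Z a x, Z (S x.1 b) x)).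
  apply: (measurable_countable_preimage (f := f) (fun q =>
    if a == q.1.1.1 then q.1.2.1 || q.1.2.2 && q.2.1
    else (a == q.1.1.2) && (q.1.2.2 && (q.1.2.1 || ~~ q.2.2)))).
  move=> [[[s sd] [x xd]] [v vs]].
  rewrite (_ : [set y | _] = [set y | [/\ X b y.1 = x, Xd b y.1 = xd,
      S y.1 b = s & Sd y.1 b = sd]] `&` ([set y | Z a y = v] `&` [set y | Z s y = vs])).
    apply: (measurableI _ _ (mfst _ (mE b s sd x xd))).
    by apply: measurableI; apply: measurable_bool_eq.
  apply/seteqP; split => y /=; rewrite /f.
    by move=> [<- <- <- <- <- <-].
  by move=> [[-> -> -> ->] [-> ->]].
- apply: filterS2 ae_allowed ae_dist => y hall hd /=.
  have allb b : allowed (X b y.1) (Xd b y.1) (Z (S y.1 b) y) (Z (Sd y.1 b) y).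
    have := hall (b, S y.1 b, Sd y.1 b); rewrite /Z piS piSd; apply => //=.
    by apply/eqP; exact: hd.
  have YS b : Y (S y.1 b) y = X b y.1 || Xd b y.1 && Z (S y.1 b) y.
    by rewrite /Y piS eqxx.
  have YSd b : Y (Sd y.1 b) y = Xd b y.1 && (X b y.1 || ~~ Z (S y.1 b) y).
    by rewrite /Y piSd eqxx; case: eqP => // /esym /hd.
  split; first by move=> a /eqP aS /eqP aSd; rewrite /Y (negbTE aS) (negbTE aSd).
  split; first by move=> b X0 Xd0; rewrite YS YSd X0 Xd0.
  split; first by move=> b X1 Xd0; rewrite YS YSd X1 Xd0.
  split; first by move=> b X1 Xd1; rewrite YS YSd X1 Xd1.
  split.
    move=> b X0 Xd1; have yS := YS b; have ySd := YSd b.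
    rewrite X0 Xd1 /= in yS ySd.
    case zS : (Z (S y.1 b) y); rewrite zS /= in yS ySd.
      exists (S y.1 b); split; [by left|split=> //].
      by move=> a [-> //|->]; rewrite ySd.
    exists (Sd y.1 b); split; [by right|split=> //].
    by move=> a [->|-> //]; rewrite yS.
  move=> a; have := allb (pi a); rewrite /Y /allowed.
  have [aS|_] := eqVneq a (S y.1 (pi a)).
    rewrite -aS; case: (X _ _) => /=; first by move=> /andP[->].
    by case: (Xd _ _).
  have [aSd|//] := eqVneq a (Sd y.1 (pi a)).
  rewrite -aSd /=; case: (Xd _ _); case: (X _ _) => //=; first by move=> /andP[_ ->].
  by case: (Z (S _ _) _) => //= ->.
(* The map sending [a] to [(pi a, a)] is injective, so the [Z a] are distinct members of the i.i.d.
   family over [B * A]. *)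
- have law (G : seq A) (v : A -> bool) : uniq G ->
      P' [set x | all (fun a => Z a x == v a) G] = (\prod_(a <- G) bern p (v a))%:E.
    move=> uG; pose H := [seq (pi a, a) | a <- G].
    have uH : uniq H by rewrite map_inj_uniq// => a a' [].
    pose Q := [set c : nat -> bool |
      all (fun x => c (choice.pickle x) == v x.2) H].
    pose N := \max_(x <- H) choice.pickle x.
    have [|_] := hz N.+1 Q setT _ measurableT.
      move=> c c' cc' /allP Qc; apply/allP => x xH; rewrite -cc' ?Qc//.
      by rewrite ltnS; exact: (leq_bigmax_seq x).
    rewrite Miid// big_map => <-; congr (P' _).
    apply/seteqP; split => x; rewrite /Q /= all_map; first by split.
    by move=> [].
  have law1 a v : P' [set x | Z a x = v] = (bern p v)%:E.
    have := law [:: a] (fun=> v) isT; rewrite big_seq1 => <-; congr (P' _).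
    by apply/seteqP; split => x /=; rewrite andbT => /eqP.
  split=> [a|F v]; first by split => //; exact: law1.
  under [RHS]eq_bigr do rewrite law1.
  rewrite prodEFin -law ?fset_uniq//; congr (P' _); apply/seteqP; split => x /=.
    by move=> h; apply/allP => a aF; apply/eqP; exact: h.
  by move=> /allP h a aF; apply/eqP; exact: h.
Qed.
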